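(* Let $\mathcal X$ be a finite set, let $q_{t-1},p_{\mathrm{pref}}\in\Delta(\mathcal X)$, let $c:\mathcal X\to[0,\infty)$ be a state-dependent cost, and let $\gamma\ge0$ and $\lambda\ge 0$. Define the exponentially tilted preferred distribution $$\widetilde p_{\mathrm{pref}}(x)=\frac{p_{\mathrm{pref}}(x)e^{-\gamma c(x)}}{\sum_{y\in\mathcal X}p_{\mathrm{pref}}(y)e^{-\gamma c(y)}},\qquad x\in\mathcal X.$$ Then the problem $$\underset{q\in\Delta(\mathcal X)}{\arg\min}\ \left\{H(q\|p_{\mathrm{pref}})+\gamma\,\mathbb E_q[c(X)]+\lambda D_{\mathrm{KL}}(q\|q_{t-1})\right\}$$ is equivalent to the problem $$\underset{q\in\Delta(\mathcal X)}{\arg\min}\ \left\{H(q\|\widetilde p_{\mathrm{pref}})+\lambda D_{\mathrm{KL}}(q\|q_{t-1})\right\},$$ that is, the two problems have the same set of minimizers.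
   Context: $\Delta(\mathcal X)=\{q\in\mathbb R_{\ge0}^{|\mathcal X|}:\sum_{x\in\mathcal X}q(x)=1\}$ is the probability simplex on the finite set $\mathcal X$. The cross-entropy is $H(q\|p)=-\sum_{x\in\mathcal X}q(x)\log p(x)\in[0,\infty]$, the Kullback--Leibler divergence is $D_{\mathrm{KL}}(q\|p)=\sum_{x\in\mathcal X}q(x)\log\frac{q(x)}{p(x)}\in[0,\infty]$ (natural logarithm; terms with $q(x)=0$ are $0$, and terms with $q(x)>0$, $p(x)=0$ are $+\infty$), and $\mathbb E_q[c(X)]=\sum_{x\in\mathcal X}q(x)c(x)$. Convention: $0\cdot\infty=0$. *)

(* Defs.v *)
From mathcomp Require Export all_boot all_order all_algebra.
From mathcomp Require Export all_classical all_reals all_analysis.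
Import Order.TTheory GRing.Theory Num.Theory.
Set Implicit Arguments.
Unset Strict Implicit.
Unset Printing Implicit Defensive.

Local Open Scope classical_set_scope.
Local Open Scope ring_scope.

Definition simplex (R : realType) (X : finType) : set (X -> R) :=
  [set q | (forall x, 0 <= q x) /\ \sum_(x : X) q x = 1].
Arguments simplex : clear implicits.

(* In \bar R we have lne 0 = -oo, 0^-1 = +oo and 0 * y = 0 for every y, so that
   in the two sums below a term with q x = 0 vanishes, and a term with q x > 0
   and p x = 0 makes the whole expression +oo. *)
Definition cross_entropy (R : realType) (X : finType) (q p : X -> R) : \bar R :=
  (- \sum_(x : X) (q x)%:E * lne (p x)%:E)%E.

Definition KL (R : realType) (X : finType) (q p : X -> R) : \bar R :=
  (\sum_(x : X) (q x)%:E * lne ((q x)%:E / (p x)%:E))%E.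

Definition expected_cost (R : realType) (X : finType) (q c : X -> R) : R :=
  \sum_(x : X) q x * c x.

Definition tilted (R : realType) (X : finType) (gamma : R) (c p : X -> R) :
    X -> R :=
  fun x => p x * expR (- gamma * c x) /
           (\sum_(y : X) p y * expR (- gamma * c y)).

(* If F is +oo on all of D, then argmin D F is all of D. *)
Definition argmin (R : realType) (T : Type) (D : set T) (F : T -> \bar R) :
    set T :=
  [set q | D q /\ forall q', D q' -> (F q <= F q')%E].

(* Main.v *)
Require Import Defs.
Import Order.TTheory GRing.Theory Num.Theory.
Set Implicit Arguments.
Unset Strict Implicit.
Unset Printing Implicit Defensive.

Local Open Scope classical_set_scope.
Local Open Scope ring_scope.

(* With Z the normalizing constant of the tilt,
   log (tilted p x) = log (p x) - gamma * c x - log Z, where -oo is allowed on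
   both sides. Averaging against q, whose weights sum to 1, the two objectives
   differ by the constant log Z, which is finite because Z > 0. *)

(** Since [a] is real, it cancels from both sides of each comparison, even where [F] is infinite. *)
Lemma argmin_addr_cst (R : realType) (T : Type) (D : set T) (F G : T -> \bar R)
    (a : R) (FG : forall q, D q -> G q = (F q + a%:E)%E) :
  argmin D F = argmin D G.
Proof.
apply/seteqP; split=> q [Dq minq]; split=> // q' Dq'; have := minq q' Dq';
  by rewrite !FG // leeD2rE.
Qed.

(** A zero sum of nonnegative terms forces each term to vanish; exponentials being positive, [p]
    would be zero everywhere, against total mass 1. *)
Lemma normalizer_gt0 (R : realType) (X : finType) (p f : X -> R)
    (hp : simplex R X p) :
  0 < \sum_(y : X) p y * expR (f y).
Proof.
have [p_ge0 sum_p] := hp.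
have pf_ge0 y : 0 <= p y * expR (f y) by rewrite mulr_ge0 ?expR_ge0.
rewrite lt_neqAle sumr_ge0 // andbT eq_sym; apply/eqP => sum0.
have p0 y : p y = 0.
  apply/eqP; have /eqP := psumr_eq0P (fun i _ => pf_ge0 i) sum0 (i := y) isT.
  by rewrite mulf_eq0 (gt_eqF (expR_gt0 _)) orbF.
by move/eqP: sum_p; rewrite big1 // eq_sym oner_eq0.
Qed.

Lemma lne_tilted (R : realType) (X : finType) (gamma : R) (c p : X -> R)
    (hp : simplex R X p) (x : X) :
  lne (tilted gamma c p x)%:E =
  (lne (p x)%:E
   - (gamma * c x + ln (\sum_(y : X) p y * expR (- gamma * c y)))%:E)%E.
Proof.
rewrite /tilted; have := normalizer_gt0 (fun y => - gamma * c y) hp.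
set Z := \sum_(y : X) _ => Z_gt0.
have := hp.1 x; rewrite le_eqVlt => /predU1P[<-|px_gt0].
  (* Here [p x = 0]: both sides are -oo, as subtracting a real leaves -oo unchanged. *)
  by rewrite !mul0r le0_lneNy.
have pe_gt0 : 0 < p x * expR (- gamma * c x) by rewrite mulr_gt0 ?expR_gt0.
rewrite !lne_EFin ?divr_gt0 // -EFinB ln_div ?posrE //.
by rewrite lnM ?posrE ?expR_gt0 // expRK opprD addrA mulNr.
Qed.

Lemma cross_entropy_tilted (R : realType) (X : finType) (gamma : R)
    (c p q : X -> R) (hp : simplex R X p) (hq : simplex R X q) :
  cross_entropy q (tilted gamma c p) =
  (cross_entropy q p + gamma%:E * (expected_cost q c)%:E
   + (ln (\sum_(y : X) p y * expR (- gamma * c y)))%:E)%E.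
Proof.
rewrite /cross_entropy /expected_cost; set Z := ln _.
(* Distributing over the difference is legitimate in [\bar R] even if [lne (p x)%:E] is -oo, because
   the subtracted term is finite. *)
have sumE x : ((q x)%:E * lne (tilted gamma c p x)%:E =
    (q x)%:E * lne (p x)%:E + (- (q x * (gamma * c x + Z)))%:E)%E.
  by rewrite lne_tilted // muleBr // fin_num_adde_defl.
under eq_bigr do rewrite sumE.
rewrite big_split /= sumEFin fin_num_oppeD // -addeA -EFinN -EFinM -EFinD.
congr (_ + _%:E)%E; rewrite sumrN opprK.
(* The constant [Z] is written as the [q]-weighted sum of itself, so that both sides compare term by
   term. *)
rewrite mulr_sumr -[X in _ = _ + X]mul1r -hq.2 mulr_suml -big_split /=.
by apply: eq_bigr => x _; rewrite mulrDr mulrCA.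
Qed.

Theorem mainTheorem3 (R : realType) (X : finType) (qprev ppref : X -> R)
    (c : X -> R) (gamma lambda : R)
    (hqprev : simplex R X qprev) (hppref : simplex R X ppref)
    (hc : forall x, 0 <= c x) (hgamma : 0 <= gamma) (hlambda : 0 <= lambda) :
  argmin (simplex R X) (fun q : X -> R =>
    (cross_entropy q ppref + gamma%:E * (expected_cost q c)%:E
     + lambda%:E * KL q qprev)%E)
  = argmin (simplex R X) (fun q : X -> R =>
    (cross_entropy q (tilted gamma c ppref) + lambda%:E * KL q qprev)%E).
Proof.
apply: argmin_addr_cst => q hq.
(* The log-normalizer moves past the KL term, which may be infinite, to become the added
   constant. *)
by rewrite cross_entropy_tilted // addeAC.
Qed.
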